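(* Let $S$ be a semiring and let $\mathfrak{a}$ be an ideal of $S$. Then $\mathfrak{a}$ is $z$-irreducible if and only if $\mathfrak{a}$ is irreducible and a $z$-ideal of $S$. Likewise, $\mathfrak{a}$ is $z$-strongly irreducible if and only if $\mathfrak{a}$ is strongly irreducible and a $z$-ideal of $S$.
   Context: A (commutative) semiring is a system $(S,+,0,\cdot,1)$ with $(S,+,0)$ and $(S,\cdot,1)$ commutative monoids, $0s=0$ for all $s\in S$, and multiplication distributing over addition. An ideal of $S$ is a nonempty subset closed under addition and under multiplication by elements of $S$. $\mathrm{Max}(S)$ is the set of maximal (proper) ideals of $S$, and for $x\in S$, $\mathcal{M}_x=\{\mathfrak{m}\in\mathrm{Max}(S)\mid x\in\mathfrak{m}\}$. An ideal $\mathfrak{z}$ of $S$ is a $z$-ideal if $\bigcap\mathcal{M}_x\subseteq\mathfrak{z}$ for every $x\in\mathfrak{z}$ (the intersection of the empty family is $S$). An ideal $\mathfrak{a}$ is irreducible if for all ideals $\mathfrak{b},\mathfrak{b}'$ of $S$, $\mathfrak{b}\cap\mathfrak{b}'=\mathfrak{a}$ implies $\mathfrak{b}=\mathfrak{a}$ or $\mathfrak{b}'=\mathfrak{a}$; it is strongly irreducible if for all ideals $\mathfrak{b},\mathfrak{b}'$ of $S$, $\mathfrak{b}\cap\mathfrak{b}'\subseteq\mathfrak{a}$ implies $\mathfrak{b}\subseteq\mathfrak{a}$ or $\mathfrak{b}'\subseteq\mathfrak{a}$. A $z$-ideal $\mathfrak{a}$ is $z$-irreducible (respectively $z$-strongly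 irreducible) if the corresponding condition holds for all $z$-ideals $\mathfrak{b},\mathfrak{b}'$ of $S$. *)

(* Defs.v *)
From mathcomp Require Import all_boot all_algebra.
From mathcomp Require Import boolp classical_sets.

Set Implicit Arguments.
Unset Strict Implicit.
Unset Printing Implicit Defensive.

Import GRing.Theory.
Local Open Scope ring_scope.
Local Open Scope classical_set_scope.

(* A [comPzSemiRingType] may be trivial: 0 = 1 is not excluded. *)
Definition ideal (S : comPzSemiRingType) (a : set S) : Prop :=
  [/\ a !=set0,
      forall x y, a x -> a y -> a (x + y)
    & forall s x, a x -> a (s * x)].

Definition maximal_ideal (S : comPzSemiRingType) (m : set S) : Prop :=
  [/\ ideal m,
      m <> setT
    & forall b : set S, ideal b -> b <> setT -> m `<=` b -> b = m].

Definition maximals_at (S : comPzSemiRingType) (x : S) : set (set S) :=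
  [set m | maximal_ideal m /\ m x].

(* The [\bigcap] over an empty family is [setT]. *)
Definition z_ideal (S : comPzSemiRingType) (z : set S) : Prop :=
  ideal z /\ forall x, z x -> \bigcap_(m in maximals_at x) m `<=` z.

(* None of the four irreducibility predicates below requires the ideal to be
   proper. *)
Definition irreducible_ideal (S : comPzSemiRingType) (a : set S) : Prop :=
  ideal a /\
  forall b b' : set S, ideal b -> ideal b' ->
    b `&` b' = a -> b = a \/ b' = a.

Definition strongly_irreducible_ideal
    (S : comPzSemiRingType) (a : set S) : Prop :=
  ideal a /\
  forall b b' : set S, ideal b -> ideal b' ->
    b `&` b' `<=` a -> b `<=` a \/ b' `<=` a.

Definition z_irreducible (S : comPzSemiRingType) (a : set S) : Prop :=
  z_ideal a /\
  forall b b' : set S, z_ideal b -> z_ideal b' ->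
    b `&` b' = a -> b = a \/ b' = a.

Definition z_strongly_irreducible
    (S : comPzSemiRingType) (a : set S) : Prop :=
  z_ideal a /\
  forall b b' : set S, z_ideal b -> z_ideal b' ->
    b `&` b' `<=` a -> b `<=` a \/ b' `<=` a.

(* Main.v *)
Require Import Defs.
From mathcomp Require Import all_boot all_algebra.
From mathcomp Require Import boolp classical_sets.

(** Maximal ideals are prime, so the intersections C(x) of the maximal ideals
containing x satisfy C(x y) = C(x) `&` C(y).  Hence a z-ideal a contains x as
soon as it contains x * x, and the colon (a : b) is again a z-ideal.  Given
ideals with b `&` b' `<=` a, the z-ideals c = (a : b) and (a : c) contain b'
and b respectively and still satisfy c `&` (a : c) `<=` a, so the
irreducibility of a among z-ideals applies to them. *)

Set Implicit Arguments.
Unset Strict Implicit.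
Unset Printing Implicit Defensive.

Import GRing.Theory.
Local Open Scope ring_scope.
Local Open Scope classical_set_scope.

Section ZIdeals.
Variable S : comPzSemiRingType.
Implicit Types (a b c m : set S) (x y s : S).

Lemma ideal0 a : ideal a -> a 0.
Proof. by case=> -[x ax] _ aM; rewrite -(mul0r x); apply: aM. Qed.

Lemma idealMr a s x : ideal a -> a x -> a (x * s).
Proof. by case=> _ _ aM ax; rewrite mulrC; apply: aM. Qed.


Lemma ideal_adjoin m x : ideal m -> ideal [set m1 + s * x | m1 in m & s in setT].
Proof.
move=> idm; have [_ mD mM] := idm; split.
- by exists (0 + 0 * x); exists 0; [exact: ideal0 | exists 0].
- move=> _ _ [u mu [s _ <-]] [v mv [t _ <-]].
  exists (u + v); first exact: mD.
  by exists (s + t) => //; rewrite mulrDl addrACA.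
- move=> r _ [u mu [s _ <-]]; exists (r * u); first exact: mM.
  by exists (r * s) => //; rewrite mulrDr mulrA.
Qed.

Lemma maximal_ideal_adjoin m x : maximal_ideal m -> ~ m x ->
  exists2 u, m u & exists s, u + s * x = 1.
Proof.
move=> [idm mT mmax] nmx.
set b := [set m1 + s * x | m1 in m & s in setT].
have mb : m `<=` b.
  by move=> u mu; exists u => //; exists 0 => //; rewrite mul0r addr0.
have bx : b x.
  by exists 0; [exact: ideal0 | exists 1 => //; rewrite mul1r add0r].
(* If [b] were proper, maximality would force [b = m], although [x] lies in [b] and not in [m]. *)
have bT : b = setT.
  apply: contrapT => bT; apply: nmx.
  by rewrite -(mmax b (ideal_adjoin x idm) bT mb).
have [u mu [s _ us]] : b 1 by rewrite bT.
by exists u => //; exists s.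
Qed.

(** When [x] is outside [m], some [u] in [m] and some [s] satisfy [u + s * x = 1]. Multiplying by
    [y] gives [y = u * y + s * (x * y)], a sum of two elements of [m]; no subtraction occurs, so the
    argument works in a semiring. *)
Lemma maximal_ideal_prime m x y :
  maximal_ideal m -> m (x * y) -> m x \/ m y.
Proof.
move=> mm mxy; have [idm mT _] := mm; have [_ mD mM] := idm.
have [mx|nmx] := pselect (m x); first by left.
right; have [u mu [s us]] := maximal_ideal_adjoin mm nmx.
rewrite -(mul1r y) -us mulrDl -mulrA.
by apply: mD; [exact: idealMr | exact: mM].
Qed.

Lemma bigcap_maximals_at_mul x y :
  \bigcap_(m in maximals_at (x * y)) m =
  \bigcap_(m in maximals_at x) m `&` \bigcap_(m in maximals_at y) m.
Proof.
apply/seteqP; split=> [t ct|t [cx cy] m [mm mxy]].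
- split=> m [mm mxy]; apply: ct; split=> //; have [idm _ _] := mm.
    exact: idealMr.
  by have [_ _ mM] := idm; apply: mM.
- by have [mx|my] := maximal_ideal_prime mm mxy; [apply: cx | apply: cy].
Qed.

Lemma z_ideal_sqr a x : z_ideal a -> a (x * x) -> a x.
Proof.
move=> [_ az] axx; apply: (az _ axx).
by rewrite bigcap_maximals_at_mul setIid => m [].
Qed.

Definition colon a b : set S := [set s | forall y, b y -> a (s * y)].

Lemma ideal_colon a b : ideal a -> ideal (colon a b).
Proof.
move=> ida; have [_ aD aM] := ida; split.
- by exists 0 => y _; rewrite mul0r; apply: ideal0.
- by move=> s t cs ct y b_y; rewrite mulrDl; apply: aD; [apply: cs | apply: ct].
- by move=> r s cs y b_y; rewrite -mulrA; apply: aM; apply: cs.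
Qed.

(** Let [t] lie in every maximal ideal containing [s], and let [y] be in [b]. A maximal ideal
    containing [s * y] contains [s], hence [t], or contains [y]; either way it contains [t * y]. As
    [s * y] is in the z-ideal [a], so is [t * y]. *)
Lemma z_ideal_colon a b : z_ideal a -> z_ideal (colon a b).
Proof.
move=> [ida az]; split=> [|s cs t ts y b_y]; first exact: ideal_colon.
apply: (az _ (cs y b_y)); rewrite bigcap_maximals_at_mul; split=> m [mm my];
  have [idm _ _] := mm; first by apply: idealMr => //; apply: ts.
by have [_ _ mM] := idm; apply: mM.
Qed.

Lemma sub_colon a b : ideal a -> a `<=` colon a b.
Proof. by move=> ida x ax y _; apply: idealMr. Qed.

Lemma sub_colon_colon a b : b `<=` colon a (colon a b).
Proof. by move=> x bx s cs; rewrite mulrC; apply: cs. Qed.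

(** A product of an element of [b'] and one of [b] lies in both ideals. *)
Lemma sub_colon_of_setI a b b' :
  ideal b -> ideal b' -> b `&` b' `<=` a -> b' `<=` colon a b.
Proof.
move=> [_ _ bM] idb' bb'a x b'x y b_y.
by apply: bb'a; split; [exact: bM | exact: idealMr].
Qed.

(** An element [x] of both sets satisfies [x * x] in [a], and z-ideals are closed under square
    roots. *)
Lemma setI_colon_sub a c : z_ideal a -> c `&` colon a c `<=` a.
Proof. by move=> za x [cx dx]; apply: (z_ideal_sqr za); apply: dx. Qed.

Lemma z_irreducible_irreducible a : z_irreducible a -> irreducible_ideal a.
Proof.
move=> [za irr]; have [ida _] := za; split=> // b b' idb idb' bb'a.
have b'c : b' `<=` colon a b by apply: sub_colon_of_setI; rewrite ?bb'a.
have ab : a `<=` b by rewrite -bb'a => x [].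
have ab' : a `<=` b' by rewrite -bb'a => x [].
(* [irr] needs an equality here, so the inclusion of [a] in both colons is used as well. *)
have cda : colon a b `&` colon a (colon a b) = a.
  apply/seteqP; split; first exact: setI_colon_sub.
  by move=> x ax; split; apply: sub_colon.
have [ca|da] := irr _ _ (z_ideal_colon _ za) (z_ideal_colon _ za) cda.
- by right; apply/seteqP; split=> //; rewrite -[X in _ `<=` X]ca.
- left; apply/seteqP; split=> //; rewrite -[X in _ `<=` X]da; exact: sub_colon_colon.
Qed.

Lemma z_strongly_irreducible_strongly_irreducible a :
  z_strongly_irreducible a -> strongly_irreducible_ideal a.
Proof.
move=> [za irr]; have [ida _] := za; split=> // b b' idb idb' bb'a.
have b'c := sub_colon_of_setI idb idb' bb'a.
have [ca|da] := irr _ _ (z_ideal_colon _ za) (z_ideal_colon _ za)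
  (setI_colon_sub (c := colon a b) za).
- by right; apply: subset_trans b'c ca.
- left; apply: subset_trans da; exact: sub_colon_colon.
Qed.

End ZIdeals.

Theorem proposition4p19 (S : comPzSemiRingType) (a : set S) (ha : ideal a) :
  (z_irreducible a <-> irreducible_ideal a /\ z_ideal a) /\
  (z_strongly_irreducible a <-> strongly_irreducible_ideal a /\ z_ideal a).
Proof.
split; split.
- by move=> za; split; [exact: z_irreducible_irreducible | case: za].
(* z-ideals are ideals, so the condition on all ideals specializes to them. *)
- by move=> [[_ irr] za]; split=> // b b' [idb _] [idb' _]; apply: irr.
- move=> za; split; last by case: za.
  exact: z_strongly_irreducible_strongly_irreducible.
- by move=> [[_ irr] za]; split=> // b b' [idb _] [idb' _]; apply: irr.
Qed.
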